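(* Let $X$ and $Y$ be Banach spaces with the weak-DD2P, and let $N$ be an absolute normalised norm on $\mathbb{R}^2$. Then the absolute sum $X\oplus_N Y$ has the weak-DD2P.
   Context: An absolute normalised norm on $\mathbb{R}^2$ is a norm $N$ with $N(a,b)=N(|a|,|b|)$ for all $(a,b)\in\mathbb{R}^2$ and $N(1,0)=N(0,1)=1$. $X\oplus_N Y$ is the product $X\times Y$ with the norm $\|(x,y)\|_N=N(\|x\|,\|y\|)$. A Banach space $Z$ (real or complex) with closed unit ball $B_Z$ has the weak-DD2P if for every non-empty relatively weakly open subset $W$ of $B_Z$ there exists $z\in W$ such that $\sup_{y\in V}\|z-y\|=2$ for every relatively weakly open subset $V$ of $B_Z$ with $z\in V$. *)

(* Defs.v *)
From HB Require Import structures.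
From mathcomp Require Import all_boot all_order all_algebra.
From mathcomp Require Import complex ring lra.
From mathcomp Require Import all_classical all_reals topology normedtype.

Set Implicit Arguments.
Unset Strict Implicit.
Unset Printing Implicit Defensive.

Import Order.TTheory GRing.Theory Num.Theory.
Import numFieldNormedType.Exports.

Local Open Scope classical_set_scope.
Local Open Scope ring_scope.

Variant scalar_kind := RealScalars | ComplexScalars.

Definition scalars (R : realType) (k : scalar_kind) : numFieldType :=
  match k with RealScalars => R | ComplexScalars => R[i] end.

(* Norms on modules over a numFieldType K take their values in K. The next two
   maps convert between nonnegative elements of K and of R. *)
Definition scalar_of_real (R : realType) (k : scalar_kind) : R -> scalars R k :=
  match k return R -> scalars R k with
  | RealScalars => fun x => x
  | ComplexScalars => fun x => (x%:C)%C
  end.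

Definition real_of_scalar (R : realType) (k : scalar_kind) : scalars R k -> R :=
  match k return scalars R k -> R with
  | RealScalars => fun x => x
  | ComplexScalars => fun x => complex.Re x
  end.

Definition rnorm (R : realType) (k : scalar_kind)
    (Z : normedModType (scalars R k)) (z : Z) : R := real_of_scalar `|z|.

Section scalars_theory.
Context (R : realType) (k : scalar_kind).
Implicit Types (x y : R).

Lemma scalar_of_realD x y :
  scalar_of_real k (x + y) = scalar_of_real k x + scalar_of_real k y.
Proof. by case: k => //=; rewrite rmorphD. Qed.

Lemma scalar_of_realM x y :
  scalar_of_real k (x * y) = scalar_of_real k x * scalar_of_real k y.
Proof. by case: k => //=; rewrite rmorphM. Qed.

Lemma scalar_of_real0 : scalar_of_real k (0 : R) = 0.
Proof. by case: k. Qed.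

Lemma le_scalar_of_real x y :
  (scalar_of_real k x <= scalar_of_real k y) = (x <= y).
Proof. by case: k => //=; rewrite lecR. Qed.

Lemma scalar_of_realK : cancel (@scalar_of_real R k) (@real_of_scalar R k).
Proof. by case: k. Qed.

Lemma real_of_scalarK (x : scalars R k) :
  0 <= x -> scalar_of_real k (real_of_scalar x) = x.
Proof.
move: x; case: k => //= -[a b].
by rewrite lecE /= => /andP[/eqP -> _].
Qed.

Lemma real_of_normK (Z : normedModType (scalars R k)) (z : Z) :
  scalar_of_real k (rnorm z) = `|z|.
Proof. exact: real_of_scalarK. Qed.

Lemma rnorm_ge0 (Z : normedModType (scalars R k)) (z : Z) : 0 <= rnorm z.
Proof. by rewrite -le_scalar_of_real real_of_normK scalar_of_real0. Qed.

Lemma rnormD (Z : normedModType (scalars R k)) (y z : Z) :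
  rnorm (y + z) <= rnorm y + rnorm z.
Proof.
by rewrite -le_scalar_of_real scalar_of_realD !real_of_normK ler_normD.
Qed.

Lemma rnormZ (Z : normedModType (scalars R k)) (c : scalars R k) (z : Z) :
  rnorm (c *: z) = real_of_scalar `|c| * rnorm z.
Proof.
apply: (can_inj scalar_of_realK).
by rewrite scalar_of_realM !real_of_normK normrZ.
Qed.

Lemma rnorm0_eq0 (Z : normedModType (scalars R k)) (z : Z) :
  rnorm z = 0 -> z = 0.
Proof.
by move=> z0; apply/normr0_eq0; rewrite -real_of_normK z0 scalar_of_real0.
Qed.

End scalars_theory.

Section weak_topology.
Context (K : numFieldType) (Z : normedModType K).

Definition continuous_dual := {f : {linear Z -> K^o} | continuous f}.

Definition weak_topology :=
  sup_topology (fun f : continuous_dual => Topological.class (initial_topology (sval f))).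

Definition weakly_open (U : set Z) : Prop := @open weak_topology U.

Definition unit_ball : set Z := [set z | `|z| <= 1].

Definition rel_weakly_open (W : set Z) : Prop :=
  exists2 U, weakly_open U & W = U `&` unit_ball.

End weak_topology.

Definition weak_DD2P (R : realType) (k : scalar_kind)
    (Z : completeNormedModType (scalars R k)) : Prop :=
  forall W : set Z, rel_weakly_open W -> W !=set0 ->
  exists2 z, W z &
    forall V : set Z, rel_weakly_open V -> V z ->
      sup [set rnorm (z - y) | y in V] = 2.

Record abs_norm (R : realType) := AbsNorm {
  abs_norm_fun :> R -> R -> R;
  abs_norm_triangle : forall a b c d,
    abs_norm_fun (a + c) (b + d) <= abs_norm_fun a b + abs_norm_fun c d;
  abs_norm_homogeneous : forall t a b,
    abs_norm_fun (t * a) (t * b) = `|t| * abs_norm_fun a b;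
  abs_norm_definite : forall a b, abs_norm_fun a b = 0 -> a = 0 /\ b = 0;
  abs_norm_absolute : forall a b, abs_norm_fun a b = abs_norm_fun `|a| `|b|;
  abs_norm10 : abs_norm_fun 1 0 = 1;
  abs_norm01 : abs_norm_fun 0 1 = 1
}.

Section abs_norm_theory.
Context (R : realType) (N : abs_norm R).
Implicit Types (a b c d : R).

Lemma abs_normx0 a : N a 0 = `|a|.
Proof.
by have := abs_norm_homogeneous N a 1 0; rewrite mulr1 mulr0 abs_norm10 mulr1.
Qed.

Lemma abs_norm0x b : N 0 b = `|b|.
Proof.
by have := abs_norm_homogeneous N b 0 1; rewrite mulr1 mulr0 abs_norm01 mulr1.
Qed.

Lemma abs_normNl a b : N (- a) b = N a b.
Proof. by rewrite abs_norm_absolute normrN -abs_norm_absolute. Qed.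

Lemma abs_normNr a b : N a (- b) = N a b.
Proof. by rewrite abs_norm_absolute normrN -abs_norm_absolute. Qed.

Lemma abs_norm_ge_l a b : `|a| <= N a b.
Proof.
have := abs_norm_triangle N a b a (- b).
by rewrite abs_normNr subrr abs_normx0 -!mulr2n normrMn lerMn2r.
Qed.

Lemma abs_norm_ge_r a b : `|b| <= N a b.
Proof.
have := abs_norm_triangle N a b (- a) b.
by rewrite abs_normNl subrr abs_norm0x -!mulr2n normrMn lerMn2r.
Qed.

Lemma abs_norm_le a b : N a b <= `|a| + `|b|.
Proof.
have := abs_norm_triangle N a 0 0 b.
by rewrite addr0 add0r abs_normx0 abs_norm0x.
Qed.

Lemma abs_norm_homo a b c d : 0 <= a -> a <= c -> 0 <= b -> b <= d ->
  N a b <= N c d.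
Proof.
have mono (g : R -> R) x y :
    (forall t s, 0 <= t -> 0 <= s -> t + s = 1 ->
       g (t * y + s * - y) <= t * g y + s * g (- y)) ->
    g (- y) = g y -> 0 <= x -> x <= y -> g x <= g y.
  move=> g_convex g_even x0 xy; have [y0|y0] := eqVneq y 0.
    by have -> : x = y by apply/le_anti; rewrite xy y0 x0.
  have yp : 0 < y by rewrite lt_def y0 (le_trans x0 xy).
  pose t : R := (1 + x / y) / 2; pose s : R := (1 - x / y) / 2.
  have t0 : 0 <= t by rewrite divr_ge0// addr_ge0// divr_ge0// ltW.
  have s0 : 0 <= s by rewrite divr_ge0// subr_ge0 ler_pdivrMr ?mul1r.
  have ts : t + s = 1 by rewrite /t /s; lra.
  have tsx : t * y + s * - y = x by rewrite /t /s; field.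
  have := g_convex t s t0 s0 ts.
  by rewrite tsx g_even -mulrDl ts mul1r.
have convex_l z y t s : 0 <= t -> 0 <= s -> t + s = 1 ->
    N (t * y + s * - y) z <= t * N y z + s * N (- y) z.
  move=> t0 s0 ts; rewrite -[in leLHS](mul1r z) -ts mulrDl.
  apply: le_trans (abs_norm_triangle _ _ _ _ _) _.
  by rewrite !abs_norm_homogeneous (ger0_norm t0) (ger0_norm s0).
have convex_r z y t s : 0 <= t -> 0 <= s -> t + s = 1 ->
    N z (t * y + s * - y) <= t * N z y + s * N z (- y).
  move=> t0 s0 ts; rewrite -[in leLHS](mul1r z) -ts mulrDl.
  apply: le_trans (abs_norm_triangle _ _ _ _ _) _.
  by rewrite !abs_norm_homogeneous (ger0_norm t0) (ger0_norm s0).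
move=> a0 ac b0 bd.
apply: (@le_trans _ _ (N c b)).
  apply: (mono (N^~ b)) => //; [exact: convex_l | exact: abs_normNl].
apply: (mono (N c)) => //; [exact: convex_r | exact: abs_normNr].
Qed.

End abs_norm_theory.

(* A copy of X * Y, so as not to inherit the library's max norm. *)
Definition abs_sum (R : realType) (k : scalar_kind) (N : abs_norm R)
  (X Y : completeNormedModType (scalars R k)) : Type := (X * Y)%type.

Section abs_sum_theory.
Context (R : realType) (k : scalar_kind) (N : abs_norm R).
Context (X Y : completeNormedModType (scalars R k)).
Local Notation S := (abs_sum N X Y).

HB.instance Definition _ := GRing.Lmodule.copy S (X * Y)%type.

Definition abs_sum_norm (p : S) : scalars R k :=
  scalar_of_real k (N (rnorm p.1) (rnorm p.2)).

Let abs_sum_normD (p q : S) :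
  abs_sum_norm (p + q) <= abs_sum_norm p + abs_sum_norm q.
Proof.
rewrite /abs_sum_norm -scalar_of_realD le_scalar_of_real.
apply: le_trans (abs_norm_triangle N _ _ _ _).
by apply: abs_norm_homo; rewrite ?rnorm_ge0 ?rnormD.
Qed.

Let abs_sum_normZ (c : scalars R k) (p : S) :
  abs_sum_norm (c *: p) = `|c| * abs_sum_norm p.
Proof.
have c_ge0 : 0 <= real_of_scalar `|c|.
  by rewrite -(le_scalar_of_real k) real_of_scalarK// scalar_of_real0.
rewrite /abs_sum_norm /= !rnormZ abs_norm_homogeneous scalar_of_realM.
by rewrite (ger0_norm c_ge0) real_of_scalarK.
Qed.

Let abs_sum_norm0_eq0 (p : S) : abs_sum_norm p = 0 -> p = 0.
Proof.
case: p => x y; rewrite /abs_sum_norm -(scalar_of_real0 R k).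
move=> /(can_inj (@scalar_of_realK R k)) /abs_norm_definite[/= x0 y0].
by rewrite (rnorm0_eq0 x0) (rnorm0_eq0 y0).
Qed.

HB.instance Definition _ := Lmodule_isNormed.Build (scalars R k) S
  abs_sum_normD abs_sum_normZ abs_sum_norm0_eq0.

Lemma abs_sum_normE (p : S) :
  `|p| = scalar_of_real k (N (rnorm p.1) (rnorm p.2)).
Proof. by []. Qed.

Let abs_sum_complete (F : set_system S) : ProperFilter F -> cauchy F -> cvg F.
Proof.
move=> FF /cauchy_ballP F_cauchy.
have le_fst (p : S) : `|p.1| <= `|p|.
  rewrite abs_sum_normE -real_of_normK le_scalar_of_real.
  by rewrite -[leLHS]ger0_norm ?rnorm_ge0// abs_norm_ge_l.
have le_snd (p : S) : `|p.2| <= `|p|.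
  rewrite abs_sum_normE -real_of_normK le_scalar_of_real.
  by rewrite -[leLHS]ger0_norm ?rnorm_ge0// abs_norm_ge_r.
have le_sum (p : S) : `|p| <= `|p.1| + `|p.2|.
  rewrite abs_sum_normE -!real_of_normK -scalar_of_realD le_scalar_of_real.
  by apply: le_trans (abs_norm_le _ _ _) _; rewrite !ger0_norm ?rnorm_ge0.
have /cauchy_cvg/cvg_ex[x Fx] : cauchy ((fun p : S => p.1) @ F).
  apply/cauchy_ballP => e e0.
  have [[A B] [/= FA FB] AB] := F_cauchy e e0.
  exists ((fun p : S => p.1) @` A, (fun p : S => p.1) @` B) => /=.
    by split; [apply: filterS FA | apply: filterS FB] => p; exists p.
  move=> [_ _] /= [[p Ap <-] [q Bq <-]].
  have := AB (p, q) (conj Ap Bq); rewrite -!ball_normE/=.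
  exact: le_lt_trans (le_fst (p - q)).
have /cauchy_cvg/cvg_ex[y Fy] : cauchy ((fun p : S => p.2) @ F).
  apply/cauchy_ballP => e e0.
  have [[A B] [/= FA FB] AB] := F_cauchy e e0.
  exists ((fun p : S => p.2) @` A, (fun p : S => p.2) @` B) => /=.
    by split; [apply: filterS FA | apply: filterS FB] => p; exists p.
  move=> [_ _] /= [[p Ap <-] [q Bq <-]].
  have := AB (p, q) (conj Ap Bq); rewrite -!ball_normE/=.
  exact: le_lt_trans (le_snd (p - q)).
apply/cvg_ex; exists ((x, y) : S).
apply/cvgrPdist_lt => e e0; near=> p.
apply: le_lt_trans (le_sum _) _; rewrite [e]splitr ltrD//=.
  by near: p; move/cvgrPdist_lt : Fx; apply; rewrite divr_gt0.
by near: p; move/cvgrPdist_lt : Fy; apply; rewrite divr_gt0.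
Unshelve. all: by end_near. Qed.

HB.instance Definition _ := Uniform_isComplete.Build S abs_sum_complete.

End abs_sum_theory.

(* Main.v *)
From HB Require Import structures.
Require Import Defs.
From mathcomp Require Import all_boot all_order all_algebra.
From mathcomp Require Import all_classical all_reals topology normedtype.
From mathcomp Require Import lra.

Set Implicit Arguments.
Unset Strict Implicit.
Unset Printing Implicit Defensive.

Import Order.TTheory GRing.Theory Num.Theory.
Import numFieldNormedType.Exports.

Local Open Scope classical_set_scope.
Local Open Scope ring_scope.

(** Call [z] a super Delta-point if every relatively weakly open subset of the
    unit ball containing [z] has points at distance almost [2] from [z]; the
    weak-DD2P asks that these points meet every non-empty relatively weakly
    open set [W].

    The mechanism is that super Delta-points are stable under absolute convex
    combinations: if [x] and [y] are super Delta-points, [a, b >= 0] and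
    [N a b = 1], then [(a x, b y)] is one as well.  Indeed the map
    [(u, v) |-> (a u, b v)] sends the product of the unit balls into the unit
    ball of the sum and is continuous for the weak topologies, so a weak
    neighbourhood of [(a x, b y)] contains [(a u, b v)] for all [u] weakly near
    [x] and [v] weakly near [y].  Choosing [u] and [v] at distance more than
    [s < 2] from [x] and [y] and using that [N] is monotone on nonnegative
    reals, the distance in the sum is at least [N (a s) (b s) = s].

    It remains to find such a combination inside [W].  Any point of the unit
    ball of the sum is [(a x0, b y0)] with [N a b = 1] and [x0], [y0] in the
    unit balls ([abs_sum_unit_ballP]): the coefficients absorb the ratio of the
    two norms, and the vectors absorb the norm of the pair.
    Weak continuity of the same map then yields weakly open sets around [x0]
    and [y0] whose combinations stay in [W] ([weakly_open_box]), and the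
    weak-DD2P of the summands replaces [x0] and [y0] by super Delta-points. *)

(** * Real-valued norms *)

Section norms.
Context (R : realType) (k : scalar_kind).

Lemma scalar_of_real1 : scalar_of_real k (1 : R) = 1.
Proof. by case: k. Qed.

Lemma rnorm0 (Z : normedModType (scalars R k)) : rnorm (0 : Z) = 0.
Proof.
apply: (can_inj (@scalar_of_realK R k)).
by rewrite real_of_normK normr0 scalar_of_real0.
Qed.

Lemma unit_ballE (Z : normedModType (scalars R k)) (z : Z) :
  unit_ball z = (rnorm z <= 1) :> Prop.
Proof.
by rewrite /unit_ball /= -real_of_normK -scalar_of_real1 le_scalar_of_real.
Qed.

Lemma rnormB_le2 (Z : normedModType (scalars R k)) (y z : Z) :
  unit_ball y -> unit_ball z -> rnorm (y - z) <= 2.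
Proof.
rewrite !unit_ballE => y1 z1; apply: le_trans (rnormD _ _) _.
by rewrite [in rnorm (- z)]/rnorm normrN -/(rnorm z); lra.
Qed.

Lemma rnorm_scale (Z : normedModType (scalars R k)) (a : R) (z : Z) :
  0 <= a -> rnorm (scalar_of_real k a *: z) = a * rnorm z.
Proof.
move=> a0; rewrite rnormZ ger0_norm ?scalar_of_realK//.
by rewrite -(scalar_of_real0 R k) le_scalar_of_real.
Qed.

Lemma scaled_unit_ball (Z : normedModType (scalars R k)) (a : R) (z : Z) :
  rnorm z <= a -> exists2 x, unit_ball x & z = scalar_of_real k a *: x.
Proof.
move=> za; have a0 : 0 <= a := le_trans (rnorm_ge0 z) za.
have [a_eq0|a_neq0] := eqVneq a 0.
  exists 0; first by rewrite unit_ballE rnorm0.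
  rewrite scaler0; apply: rnorm0_eq0; apply/le_anti.
  by rewrite rnorm_ge0 -[X in _ <= X]a_eq0 za.
have ap : 0 < a by rewrite lt_def a_neq0.
exists (scalar_of_real k a^-1 *: z).
  by rewrite unit_ballE rnorm_scale ?invr_ge0// mulrC ler_pdivrMr ?mul1r.
by rewrite scalerA -scalar_of_realM divff// scalar_of_real1 scale1r.
Qed.

End norms.

(** * Continuity for weak topologies *)

Lemma dual_weakly_continuous (K : numFieldType) (Z : normedModType K)
    (f : continuous_dual Z) :
  continuous (sval f : weak_topology Z -> K^o).
Proof.
move=> x; apply: cvg_comp; last exact: (@initial_continuous Z K^o (sval f)).
have /cvg_sup/(_ f) : nbhs (x : weak_topology Z) --> (x : weak_topology Z).
  exact: cvg_id.
exact.
Qed.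

(** The universal property of the weak topology as an initial topology. *)
Lemma continuous_to_weak (K : numFieldType) (Z : normedModType K)
    (T : topologicalType) (g : T -> weak_topology Z) :
  (forall f : continuous_dual Z, continuous (sval f \o g : T -> K^o)) ->
  continuous g.
Proof.
move=> fg x; apply/cvg_sup => f.
exact: (@continuous_comp_initial Z T K^o (sval f) g (fg f)).
Qed.

(** * Weak neighbourhoods in an absolute sum *)

Section summands.
Context (R : realType) (k : scalar_kind) (N : abs_norm R).
Context (X Y : completeNormedModType (scalars R k)).
Local Notation K := (scalars R k).
Local Notation S := (abs_sum N X Y).

Definition abs_sum_inl (x : X) : S := (x, 0).
Definition abs_sum_inr (y : Y) : S := (0, y).

Let abs_sum_inl_linear : linear abs_sum_inl.
Proof. by move=> t u v; congr (_, _); rewrite /= scaler0 addr0. Qed.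

Let abs_sum_inr_linear : linear abs_sum_inr.
Proof. by move=> t u v; congr (_, _); rewrite /= scaler0 addr0. Qed.

HB.instance Definition _ :=
  GRing.isLinear.Build K X S _ abs_sum_inl abs_sum_inl_linear.
HB.instance Definition _ :=
  GRing.isLinear.Build K Y S _ abs_sum_inr abs_sum_inr_linear.

Lemma rnorm_abs_sum (p : S) : rnorm p = N (rnorm p.1) (rnorm p.2).
Proof. by rewrite {1}/rnorm abs_sum_normE scalar_of_realK. Qed.

Lemma norm_abs_sum_inl x : `|abs_sum_inl x| = `|x|.
Proof.
by rewrite -!real_of_normK rnorm_abs_sum rnorm0 abs_normx0 ger0_norm ?rnorm_ge0.
Qed.

Lemma norm_abs_sum_inr y : `|abs_sum_inr y| = `|y|.
Proof.
by rewrite -!real_of_normK rnorm_abs_sum rnorm0 abs_norm0x ger0_norm ?rnorm_ge0.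
Qed.

Lemma abs_sum_inl_continuous : continuous abs_sum_inl.
Proof.
move=> z; apply/cvgrPdist_lt => e e0.
have /cvgrPdist_lt/(_ e e0) : idfun @ z --> z by exact: cvg_id.
by apply: filterS => w; rewrite -linearB norm_abs_sum_inl.
Qed.

Lemma abs_sum_inr_continuous : continuous abs_sum_inr.
Proof.
move=> z; apply/cvgrPdist_lt => e e0.
have /cvgrPdist_lt/(_ e e0) : idfun @ z --> z by exact: cvg_id.
by apply: filterS => w; rewrite -linearB norm_abs_sum_inr.
Qed.

Definition dual_inl (f : continuous_dual S) : continuous_dual X.
Proof.
exists (sval f \o abs_sum_inl : {linear X -> K^o}).
move=> x; apply: continuous_comp; last exact: (svalP f).
exact: abs_sum_inl_continuous.
Defined.

Definition dual_inr (f : continuous_dual S) : continuous_dual Y.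
Proof.
exists (sval f \o abs_sum_inr : {linear Y -> K^o}).
move=> x; apply: continuous_comp; last exact: (svalP f).
exact: abs_sum_inr_continuous.
Defined.

(** A functional on the sum splits as [f (x, y) = f (x, 0) + f (0, y)], and
    both terms come from functionals on the summands. *)
Lemma scaled_pair_weakly_continuous (c d : K) :
  continuous (fun q : weak_topology X * weak_topology Y =>
    ((c *: (q.1 : X), d *: (q.2 : Y)) : weak_topology S)).
Proof.
apply: continuous_to_weak => f.
have -> : sval f \o (fun q : weak_topology X * weak_topology Y =>
    ((c *: (q.1 : X), d *: (q.2 : Y)) : weak_topology S)) =
  (fun q => c *: (sval (dual_inl f) q.1 : K^o)
            + d *: (sval (dual_inr f) q.2 : K^o)).
  apply/funext => -[x y] /=; rewrite -!linearZ -linearD; congr (sval f _).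
  by congr (_, _); rewrite /= ?addr0 ?add0r.
move=> q; apply: cvgD; apply: cvgZl_tmp.
  apply: (@continuous_comp (weak_topology X * weak_topology Y)%type
    (weak_topology X) K^o fst (sval (dual_inl f)) q).
    exact: cvg_fst.
  exact: dual_weakly_continuous.
apply: (@continuous_comp (weak_topology X * weak_topology Y)%type
  (weak_topology Y) K^o snd (sval (dual_inr f)) q).
  exact: cvg_snd.
exact: dual_weakly_continuous.
Qed.

(** Used both to find a super Delta-point in a given open set and to find points
    far from it. *)
Lemma weakly_open_box (U : set S) (c d : K) (x : X) (y : Y) :
  weakly_open U -> U (c *: x, d *: y) ->
  exists2 A : set X, weakly_open A /\ A x &
  exists2 B : set Y, weakly_open B /\ B y &
  forall u v, A u -> B v -> U (c *: u, d *: v).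
Proof.
move=> Uo Uxy.
have Unbhs : nbhs ((c *: x, d *: y) : weak_topology S) U.
  by apply: open_nbhs_nbhs; split.
pose q : weak_topology X * weak_topology Y := (x, y).
have [[A B] /= [xA yB] AB] := @scaled_pair_weakly_continuous c d q U Unbhs.
move: xA yB; rewrite !nbhsE => -[A' [A'o A'x] A'A] [B' [B'o B'y] B'B].
exists A' => //; exists B' => // u v /A'A Au /B'B Bv.
exact: (AB (u, v)).
Qed.

End summands.

(** * Super Delta-points *)

Section super_delta.
Context (R : realType) (k : scalar_kind).

Definition super_delta_point (Z : normedModType (scalars R k)) (z : Z) : Prop :=
  forall V : set Z, rel_weakly_open V -> V z ->
    sup [set rnorm (z - y) | y in V] = 2.

(** In the unit ball distances never exceed [2], so only the lower bound on the
    supremum carries information. *)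
Lemma super_delta_pointP (Z : normedModType (scalars R k)) (z : Z) :
  unit_ball z -> super_delta_point z <->
  forall V : set Z, rel_weakly_open V -> V z ->
    forall t, t < 2 -> exists2 y, V y & t < rnorm (z - y).
Proof.
move=> z1.
have dist_le2 V : rel_weakly_open V ->
    ubound [set rnorm (z - y) | y in V] 2.
  by move=> [U _ ->] _ [y [_ y1] <-]; exact: rnormB_le2.
have dist_n0 (V : set Z) : V z -> [set rnorm (z - y) | y in V] !=set0.
  by move=> Vz; exists (rnorm (z - z)), z.
have dist_sup V : rel_weakly_open V -> V z ->
    has_sup [set rnorm (z - y) | y in V].
  by move=> Vo Vz; split; [exact: dist_n0|exists 2; exact: dist_le2].
split=> zV V Vo Vz; last first.
  apply/le_anti/andP; split.
    by apply: ge_sup; [exact: dist_n0|exact: dist_le2].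
  rewrite leNgt; apply/negP => /(zV _ Vo Vz)[y Vy]; apply/negP.
  by rewrite -leNgt; apply: sup_upper_bound (dist_sup _ Vo Vz) _ _; exists y.
move=> t t2; have t0 : 0 < 2 - t by rewrite subr_gt0.
have [_ [y Vy <-]] := sup_adherent t0 (dist_sup _ Vo Vz).
by rewrite (zV _ Vo Vz) subKr; exists y.
Qed.

End super_delta.

(** * Absolute combinations in the unit ball *)

Section abs_sum_delta.
Context (R : realType) (k : scalar_kind) (N : abs_norm R).
Context (X Y : completeNormedModType (scalars R k)).
Local Notation S := (abs_sum N X Y).
Local Notation "a %:K" := (scalar_of_real k a) (at level 2, format "a %:K").

Lemma unit_ball_abs_sum (a b : R) (x : X) (y : Y) :
  0 <= a -> 0 <= b -> N a b = 1 -> unit_ball x -> unit_ball y ->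
  unit_ball ((a%:K *: x, b%:K *: y) : S).
Proof.
move=> a0 b0 Nab; rewrite !unit_ballE => x1 y1.
rewrite rnorm_abs_sum /= !rnorm_scale// -Nab.
by apply: abs_norm_homo; rewrite ?mulr_ge0 ?rnorm_ge0// ler_piMr.
Qed.

(** With [r] the norm of the pair [(u, v)], the coefficients are the norms of
    [u] and [v] divided by [r]; as [r <= 1] they dominate those norms, so the
    vectors left after dividing them out are in the unit balls. *)
Lemma abs_sum_unit_ballP (p : S) : unit_ball p ->
  exists a b : R, [/\ 0 <= a, 0 <= b & N a b = 1] /\
  exists (x : X) (y : Y), [/\ unit_ball x, unit_ball y &
    p = (a%:K *: x, b%:K *: y)].
Proof.
case: p => u v; rewrite unit_ballE => r1.
suff : exists a b : R,
    [/\ 0 <= a, 0 <= b & N a b = 1] /\ rnorm u <= a /\ rnorm v <= b.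
  move=> [a [b [abN [ua vb]]]].
  have [x x1 ->] := scaled_unit_ball ua.
  have [y y1 ->] := scaled_unit_ball vb.
  by exists a, b; split => //; exists x, y.
set r := rnorm _ in r1; have r0 : 0 <= r := rnorm_ge0 _.
have rE : r = N (rnorm u) (rnorm v) by exact: rnorm_abs_sum.
have [r_eq0|r_neq0] := eqVneq r 0.
  (* At the origin any coefficients with N a b = 1 do. *)
  have [-> ->] : rnorm u = 0 /\ rnorm v = 0.
    by apply: (@abs_norm_definite _ N); rewrite -rE.
  by exists 1, 0; rewrite abs_norm10 !lexx ler01.
have rp : 0 < r by rewrite lt_def r_neq0.
exists (r^-1 * rnorm u), (r^-1 * rnorm v).
have ri : 1 <= r^-1 by rewrite invf_ge1.
rewrite abs_norm_homogeneous -rE ger0_norm ?invr_ge0// mulVf//.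
by rewrite !mulr_ge0 ?invr_ge0 ?rnorm_ge0// !ler_peMl ?rnorm_ge0.
Qed.

(** The distance from [(a x, b y)] to [(a u, b v)] is
    [N (a |x - u|) (b |y - v|)], which is almost [N (2 a) (2 b) = 2] when [u]
    and [v] are almost at distance [2] from [x] and [y]. *)
Lemma super_delta_point_abs_sum (a b : R) (x : X) (y : Y) :
  0 <= a -> 0 <= b -> N a b = 1 -> unit_ball x -> unit_ball y ->
  super_delta_point x -> super_delta_point y ->
  super_delta_point ((a%:K *: x, b%:K *: y) : S).
Proof.
move=> a0 b0 Nab x1 y1 /(super_delta_pointP x1) dx /(super_delta_pointP y1) dy.
apply/super_delta_pointP; first exact: unit_ball_abs_sum.
move=> V [U Uo ->] [/(weakly_open_box Uo)[A [Ao Ax] [B [Bo By] ABU]] _] t t2.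
(* A bound strictly between t and 2, made nonnegative so that N is monotone. *)
pose s := Num.max 0 ((t + 2) / 2).
have [s0 ts s2] : [/\ 0 <= s, t < s & s < 2].
  by rewrite /s le_max lexx gt_max lt_max; split => //; lra.
have [|//|u [Au u1] xu] := dx (A `&` @unit_ball _ X) _ _ s s2.
  by exists A.
have [|//|v [Bv v1] yv] := dy (B `&` @unit_ball _ Y) _ _ s s2.
  by exists B.
exists (a%:K *: u, b%:K *: v).
  by split; [exact: ABU|exact: unit_ball_abs_sum].
apply: (lt_le_trans ts); rewrite rnorm_abs_sum /= -!scalerBr !rnorm_scale//.
have -> : s = N (s * a) (s * b).
  by rewrite abs_norm_homogeneous Nab mulr1 ger0_norm.
by apply: abs_norm_homo; rewrite ?mulr_ge0// mulrC ler_wpM2l// ltW.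
Qed.

End abs_sum_delta.

(** * Stability of the weak-DD2P *)

Theorem proposition3p1 (R : realType) (k : scalar_kind)
  (X Y : completeNormedModType (scalars R k)) (N : abs_norm R) :
  weak_DD2P X -> weak_DD2P Y -> weak_DD2P (abs_sum N X Y).
Proof.
move=> dX dY W [U Uo ->] [p [Up /abs_sum_unit_ballP]].
move=> [a [b [[a0 b0 Nab] [x0 [y0 [x01 y01 pE]]]]]].
have [A [Ao Ax] [B [Bo By] ABU]] := weakly_open_box Uo (eq_rect p U Up _ pE).
have [||x [Xx x1] dx] := dX (A `&` @unit_ball _ X).
- by exists A.
- by exists x0.
have [||y [Yy y1] dy] := dY (B `&` @unit_ball _ Y).
- by exists B.
- by exists y0.
exists (scalar_of_real k a *: x, scalar_of_real k b *: y).
  by split; [exact: ABU|exact: unit_ball_abs_sum].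
exact: super_delta_point_abs_sum.
Qed.
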